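(* Let $Y$ be a compact space. There exists a non-trivial, rank 1 Rieffel projection in $M_2(C(Y\times S^1))$ if and only if there exist $a,b,\alpha,\beta,\gamma\in C(Y)$, with $a$ real-valued and $|\beta|^2+|\gamma|^2\neq 0$ (i.e. not the zero function on $Y$), such that: (1) $\beta\gamma=-\alpha^2$; (2) $(2a-1)\alpha+b\gamma+\overline{b}\beta=0$; (3) $a=a^2+|b|^2+2|\alpha|^2+|\beta|^2+|\gamma|^2$. In that case the Rieffel projection is $P(y,\varphi)=\exp(-2\pi i\varphi)X_1(y)^*+X_0(y)+\exp(2\pi i\varphi)X_1(y)$ with $X_0=\begin{pmatrix}a & b\\ \overline{b} & 1-a\end{pmatrix}$ and $X_1=\begin{pmatrix}\alpha & \beta\\ \gamma & -\alpha\end{pmatrix}$.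
   Context: $C(Y)$ denotes the algebra of continuous complex-valued functions on $Y$. Points of $S^1$ are written $\exp(2\pi i\varphi)$, $\varphi\in[0,1]$. A Rieffel projection in $M_2(C(Y\times S^1))$ is a projection $P$ (i.e. $P=P^*=P^2$) of the form $$P(y,\varphi)=\exp(-2\pi i\varphi)X_1(y)^*+X_0(y)+\exp(2\pi i\varphi)X_1(y),$$ with $X_0,X_1\in M_2(C(Y))$ and $X_0=X_0^*$. It is called non-trivial if $X_1\neq 0$ (as an element of $M_2(C(Y))$), and it is said to have rank 1 if $P(y,\varphi)$ has rank 1 for every $(y,\varphi)\in Y\times[0,1]$. *)

(* Defs.v *)
From HB Require Import structures.
From mathcomp Require Import all_boot all_order all_algebra.
From mathcomp Require Import all_classical all_reals all_analysis.
From mathcomp Require Import complex.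

Set Implicit Arguments.
Unset Strict Implicit.
Unset Printing Implicit Defensive.

Import Order.TTheory GRing.Theory Num.Theory.
Import numFieldNormedType.Exports.

Local Open Scope classical_set_scope.
Local Open Scope ring_scope.
Local Open Scope sesquilinear_scope.

(* The usual topology of the complex numbers, given by the modulus. *)
HB.instance Definition _ (R : rcfType) := NormedModule.copy R[i] R[i]^o.

(* C(T), for any topological space T; it is the zero ring when T is empty,
   whence the possibly-zero ring structure below. *)
Notation contC R T := (continuousType T R[i]).

Section ContinuousFunctions.
Variables (R : realType) (T : topologicalType).
Implicit Types f g : contC R T.

Definition cont_pred : {pred T -> R[i]} :=
  mem [set f : T -> R[i] | continuous f].

Definition cont_Sub (f : T -> R[i]) (fP : f \in cont_pred) : contC R T :=
  mkcts (set_mem fP).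

Lemma cont_rect (K : contC R T -> Type) :
  (forall (f : T -> R[i]) (fP : f \in cont_pred), K (cont_Sub fP)) -> forall u, K u.
Proof.
move=> Ksub f.
have fP : Continuous.sort f \in cont_pred by apply/mem_set; exact: cts_fun.
by have <- : cont_Sub fP = f by apply/continuousEP.
Qed.

Lemma cont_subK (f : T -> R[i]) (fP : f \in cont_pred) :
  cont_Sub fP = f :> (T -> R[i]).
Proof. by []. Qed.

HB.instance Definition _ := isSub.Build _ _ (contC R T) cont_rect cont_subK.

Lemma cont_subring_closed : subring_closed cont_pred.
Proof.
split=> [|f g /set_mem fc /set_mem gc|f g /set_mem fc /set_mem gc];
  apply/mem_set => x.
- exact: cst_continuous.
- by apply: continuousB; [exact: fc | exact: gc].
- by apply: continuousM; [exact: fc | exact: gc].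
Qed.

HB.instance Definition _ :=
  GRing.isSubringClosed.Build _ cont_pred cont_subring_closed.
HB.instance Definition _ :=
  GRing.SubChoice_isSubComPzRing.Build _ cont_pred (contC R T)
    cont_subring_closed.

Lemma contC_conj_subproof f : continuous (fun x => (f x)^*).
Proof.
move=> x; apply/cvgrPdist_lt => e e0.
have /cvgrPdist_lt/(_ e e0) := @cts_fun _ _ f x.
by apply: filterS => t; rewrite -rmorphB norm_conjC.
Qed.

Lemma contC_norm_subproof f : continuous (fun x => `|f x|).
Proof.
move=> x; apply/cvgrPdist_lt => e e0.
have /cvgrPdist_lt/(_ e e0) := @cts_fun _ _ f x.
by apply: filterS => t; apply: le_lt_trans; exact: ler_dist_dist.
Qed.

Definition contC_conj f : contC R T := mkcts (@contC_conj_subproof f).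
Definition contC_norm f : contC R T := mkcts (@contC_norm_subproof f).

(* The involution of the *-algebra M_n(C(T)). *)
Definition contC_adj n (A : 'M[contC R T]_n) : 'M[contC R T]_n :=
  (map_mx contC_conj A)^T.

Definition contC_eval n (A : 'M[contC R T]_n) (x : T) : 'M[R[i]]_n :=
  map_mx (fun f : contC R T => f x) A.

Definition is_projection n (P : 'M[contC R T]_n) : Prop :=
  P = contC_adj P /\ P *m P = P.

End ContinuousFunctions.

Definition circle (R : realType) : set R[i] := [set z | `|z| = 1].
Arguments circle : clear implicits.

Section Circle.
Variable R : realType.

(* expi2pi phi = exp (2 pi i phi) *)
Definition expi2pi (phi : R) : R[i] :=
  Complex (cos (2 * pi * phi)) (sin (2 * pi * phi)).

Lemma expi2pi_circle phi : expi2pi phi \in circle R.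
Proof.
by apply/mem_set; rewrite /circle /= normc_def /= cos2Dsin2 sqrtr1.
Qed.

Definition circle_pt (phi : R) : circle R :=
  exist (fun z => z \in circle R) _ (expi2pi_circle phi).

End Circle.

Section Rieffel.
Variables (R : realType) (Y : topologicalType).

(* The carrier of [circle R] has the subspace topology, so Y * circle R is the
   topological product Y x S^1. *)
Definition rieffel_projection (P : 'M[contC R (Y * circle R)%type]_2)
    (X0 X1 : 'M[contC R Y]_2) : Prop :=
  [/\ is_projection P,
      X0 = contC_adj X0 &
      forall (y : Y) (phi : R), 0 <= phi <= 1 ->
        contC_eval P (y, circle_pt phi) =
          expi2pi (- phi) *: (contC_eval X1 y)^t* + contC_eval X0 y
          + expi2pi phi *: contC_eval X1 y].

Definition rank_one (P : 'M[contC R (Y * circle R)%type]_2) : Prop :=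
  forall (y : Y) (phi : R), 0 <= phi <= 1 ->
    \rank (contC_eval P (y, circle_pt phi)) = 1%N.

Definition nontrivial_rank_one_rieffel (P : 'M[contC R (Y * circle R)%type]_2)
    (X0 X1 : 'M[contC R Y]_2) : Prop :=
  [/\ rieffel_projection P X0 X1, X1 <> 0 & rank_one P].

Definition mx22 (K : Type) (a b c d : K) : 'M[K]_2 :=
  \matrix_(i, j) if i == 0 then (if j == 0 then a else b)
                 else (if j == 0 then c else d).

Definition rieffel_data (a b alpha beta gamma : contC R Y) : Prop :=
  [/\ forall y, a y \is Num.real,
      contC_norm beta ^+ 2 + contC_norm gamma ^+ 2 <> 0,
      beta * gamma = - alpha ^+ 2,
      (2 * a - 1) * alpha + b * gamma + contC_conj b * beta = 0 &
      a = a ^+ 2 + contC_norm b ^+ 2 + 2 * contC_norm alpha ^+ 2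
          + contC_norm beta ^+ 2 + contC_norm gamma ^+ 2].

End Rieffel.

(* Main.v *)
Require Import Defs.
From mathcomp Require Import all_boot all_order all_algebra.
From mathcomp Require Import all_classical all_reals all_analysis.
From mathcomp Require Import complex.
From mathcomp Require Import ring lra.
Local Open Scope classical_set_scope.
Local Open Scope ring_scope.

Set Implicit Arguments.
Unset Strict Implicit.
Unset Printing Implicit Defensive.

Import Order.TTheory GRing.Theory Num.Theory.
Local Open Scope sesquilinear_scope.

(** The point is that a 2 x 2 matrix over a field is an idempotent of rank one
    exactly when its trace is 1 and its determinant is 0: by Cayley-Hamilton,
    A^2 = tr(A) A - det(A).  This is [idempotent_rank1], and it turns both
    requirements on P, that it be a projection and that it have rank one, into
    two scalar equations at each point of Y x S^1.

    Fix y in Y and let z run over the unit circle.  The trace and determinant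
    of z^* X1^* + X0 + z X1, with X0 Hermitian, are trigonometric polynomials
    in z of degree at most 1 and 2, whose coefficients of z^-k and z^k are
    conjugate.  Such a polynomial vanishes on the circle only if its
    coefficients do ([hermitian_trig_poly_eq0]).

    Hence the trace is identically 1 if and only if tr X0 = 1 and tr X1 = 0,
    which together with X0 = X0^* gives the announced shapes of X0 and X1.  For
    matrices of these shapes [det_laurent_mx22] computes the determinant: its
    coefficients of degree 2, 1 and 0 are, up to sign, the differences of the
    two sides of equations (1), (2) and (3).  The equations are therefore
    equivalent to the vanishing of the determinant on the whole circle.

    In one direction this makes the Laurent expression a projection of rank
    one at every point; its entries are built from continuous functions and
    from the coordinate of S^1, so it lies in M_2(C(Y x S^1)).  In the other
    direction the functions a, b, alpha, beta, gamma are entries of X0 and X1.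
    Finally, by (1), beta = gamma = 0 forces alpha = 0, so X1 is nonzero if and
    only if one of beta and gamma is. *)

(** * Rank-one idempotents of size two *)

Lemma forall_ord2 (Q : 'I_2 -> Prop) : Q 0 -> Q 1 -> forall i, Q i.
Proof.
move=> Q0 Q1 [[|[|//]] lti].
  by have -> : Ordinal lti = 0 by exact: val_inj.
by have -> : Ordinal lti = 1 by exact: val_inj.
Qed.

Lemma matrix2P (K : Type) (A B : 'M[K]_2) :
  A 0 0 = B 0 0 -> A 0 1 = B 0 1 -> A 1 0 = B 1 0 -> A 1 1 = B 1 1 -> A = B.
Proof.
move=> e00 e01 e10 e11; apply/matrixP => i j; move: i j.
by apply: forall_ord2; apply: forall_ord2.
Qed.

Lemma sum_ord2 (K : pzSemiRingType) (F : 'I_2 -> K) :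
  \sum_i F i = F 0 + F 1.
Proof.
rewrite big_ord_recl big_ord1; congr (F _ + F _); exact: val_inj.
Qed.

Lemma mxtrace2 (K : pzSemiRingType) (A : 'M[K]_2) : \tr A = A 0 0 + A 1 1.
Proof. exact: sum_ord2. Qed.

Lemma mulmx2E (K : pzSemiRingType) (A B : 'M[K]_2) i j :
  (A *m B) i j = A i 0 * B 0 j + A i 1 * B 1 j.
Proof. by rewrite mxE sum_ord2. Qed.

Lemma det2 (K : comPzRingType) (A : 'M[K]_2) :
  \det A = A 0 0 * A 1 1 - A 0 1 * A 1 0.
Proof.
rewrite (expand_det_row A 0) sum_ord2 /cofactor !det_mx11 !mxE /=.
have -> : lift 0 0 = 1 :> 'I_2 by exact: val_inj.
have -> : lift 1 0 = 0 :> 'I_2 by exact: val_inj.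
by rewrite !expr0 expr1 mul1r mulN1r mulrN.
Qed.

Lemma Cayley_Hamilton2 (K : comPzRingType) (A : 'M[K]_2) :
  A *m A = \tr A *: A - (\det A)%:M.
Proof.
by apply: matrix2P; rewrite mulmx2E !mxE mxtrace2 det2 /= ?mulr1n ?mulr0n; ring.
Qed.

(** Cayley-Hamilton reads A^2 = tr(A) A - det(A).  An idempotent of rank one is
    singular and nonzero, so this forces (tr(A) - 1) A = 0, hence tr(A) = 1.
    Conversely a singular matrix has rank at most one, and one of trace 1 is
    not zero. *)
Lemma idempotent_rank1 (K : fieldType) (A : 'M[K]_2) :
  (A *m A = A /\ \rank A = 1) <-> (\tr A = 1 /\ \det A = 0).
Proof.
split=> [[AA rA]|[tA dA]].
  have dA : \det A = 0.
    apply/eqP; apply: contraT => dA0.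
    have : A \in unitmx by rewrite unitmxE unitfE.
    by rewrite -row_full_unit /row_full rA.
  split=> //; apply/eqP; rewrite -subr_eq0; apply: contraT => tA1.
  have : (\tr A - 1) *: A = 0.
    by rewrite scalerBl scale1r -{3}AA Cayley_Hamilton2 dA raddf0 subr0 subrr.
  move/eqP; rewrite scalemx_eq0 (negPf tA1) => /eqP A0.
  by move: rA; rewrite A0 mxrank0.
split; first by rewrite Cayley_Hamilton2 tA dA scale1r raddf0 subr0.
apply/eqP; rewrite eqn_leq lt0n mxrank_eq0; apply/andP; split.
  have := rank_leq_row A; rewrite leq_eqVlt => /orP[|//] fA.
  have : A \in unitmx by rewrite -row_free_unit.
  by rewrite unitmxE unitfE dA eqxx.
by apply: contra_eq_neq tA => ->; rewrite mxtrace0 eq_sym oner_eq0.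
Qed.

(** * Hermitian trigonometric polynomials *)

Section Trigonometric.
Variable R : realType.
Implicit Type phi : R.

Lemma expi2piD phi psi : expi2pi (phi + psi) = expi2pi phi * expi2pi psi.
Proof.
rewrite /expi2pi mulrDr cosD sinD.
by apply/eqP; rewrite eq_complex /= eqxx addrC /= [X in _ == X + _]mulrC mulrC.
Qed.

Lemma expi2piN phi : expi2pi (- phi) = (expi2pi phi)^*.
Proof. by rewrite /expi2pi mulrN cosN sinN. Qed.

Lemma expi2pi0 : expi2pi (0 : R) = 1.
Proof. by rewrite /expi2pi mulr0 cos0 sin0. Qed.

Lemma expi2pi_half : expi2pi (2^-1 : R) = -1.
Proof.
rewrite /expi2pi mulrAC divff ?pnatr_eq0// mul1r cospi sinpi.
by apply/eqP; rewrite eq_complex /= oppr0 !eqxx.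
Qed.

(** The fourth roots of unity do not suffice: there z^2 is 1 or -1, so that only
    the real part of c2 can be read off.  They do give c0 = c1 = 0, after which
    the value at a square root w of i, where w^2 c2 and its conjugate add up to
    -2 Im c2, gives the imaginary part. *)
Lemma hermitian_trig_poly_eq0 (c0 c1 c2 : R[i]) :
  (forall phi, 0 <= phi <= 1 -> let z := expi2pi phi in
     z^* ^+ 2 * c2^* + z^* * c1^* + c0 + z * c1 + z ^+ 2 * c2 = 0) ->
  [/\ c0 = 0, c1 = 0 & c2 = 0].
Proof.
move=> f0.
pose i := expi2pi (4^-1 : R); pose w := expi2pi (8^-1 : R).
have ii : i ^+ 2 = -1.
  by rewrite expr2 -expi2piD -expi2pi_half; congr expi2pi; field.
have ww : w ^+ 2 = i by rewrite expr2 -expi2piD; congr expi2pi; field.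
have iC : i^* = - i.
  have : i * i^* = 1 by rewrite -expi2piN -expi2piD subrr expi2pi0.
  move=> /(congr1 ( *%R (- i))); rewrite mulrA mulNr -expr2 ii opprK mul1r.
  by rewrite mulr1.
have i0 : i != 0.
  by apply: contra_eq_neq ii => ->; rewrite expr0n eq_sym oppr_eq0 oner_eq0.
have i34 : expi2pi (3 / 4 : R) = - i.
  have -> : 3 / 4 = 2^-1 + 4^-1 :> R by field.
  by rewrite expi2piD expi2pi_half mulN1r.
have := f0 0; rewrite expi2pi0 => /(_ _)/= f1.
have := f0 2^-1; rewrite expi2pi_half => /(_ _)/= f2.
have := f0 4^-1; rewrite -/i => /(_ _)/= f3.
have := f0 (3 / 4); rewrite i34 => /(_ _)/= f4.
have := f0 8^-1; rewrite -/w => /(_ _)/= f5.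
have {}f1 := f1 ltac:(lra).
have {}f2 := f2 ltac:(lra).
have {}f3 := f3 ltac:(lra).
have {}f4 := f4 ltac:(lra).
have {}f5 := f5 ltac:(lra).
move: f1 f2 f3 f4 f5.
rewrite -[w^* ^+ 2]rmorphXn /= ww !rmorphN !rmorph1 /= iC.
rewrite !(sqrrN, expr1n, mul1r, mulN1r) ii.
move=> f1 f2 f3 f4.
have n2 : (2 : R[i]) != 0 by rewrite pnatr_eq0.
have n4 : (4 : R[i]) != 0 by rewrite pnatr_eq0.
have comb a b (x y : R[i]) : x = 0 -> y = 0 -> a * x + b * y = 0.
  by move=> -> ->; rewrite !mulr0 addr0.
have f12 := comb 1 1 _ _ f1 f2; have f34 := comb 1 1 _ _ f3 f4.
(* Averaging over the fourth roots of unity isolates the constant term. *)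
have e0 : c0 = 0.
  by apply: (mulfI n4); rewrite mulr0; apply: etrans (comb 1 1 _ _ f12 f34); ring.
have e1 : c1 = 0.
  have h1 : c1^* + c1 = 0.
    apply: (mulfI n2); rewrite mulr0.
    by apply: etrans (comb 1 (-1) _ _ f1 f2); ring.
  have h2 : c1 - c1^* = 0.
    apply: (mulfI (mulf_neq0 n2 i0)); rewrite mulr0.
    by apply: etrans (comb 1 (-1) _ _ f3 f4); ring.
  by apply: (mulfI n2); rewrite mulr0; apply: etrans (comb 1 1 _ _ h1 h2); ring.
rewrite e1 e0 rmorph0 !mulr0 !addr0 => f5.
split=> //.
have h1 : c2^* + c2 = 0.
  apply: (mulfI n2); rewrite mulr0.
  by apply: etrans (comb 1 (-2) _ _ f12 e0); ring.
have h2 : c2 - c2^* = 0.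
  by apply: (mulfI i0); rewrite mulr0 -f5; ring.
by apply: (mulfI n2); rewrite mulr0; apply: etrans (comb 1 1 _ _ h1 h2); ring.
Qed.

End Trigonometric.

(** * The equations at a point of the base *)

Section Pointwise.
Variable R : realType.
Implicit Type z : R[i].

Definition laurent_mx (A0 A1 : 'M[R[i]]_2) z : 'M[R[i]]_2 :=
  z^* *: A1^t* + A0 + z *: A1.

Definition rieffel_eqs (a b alpha beta gamma : R[i]) : Prop :=
  [/\ beta * gamma = - alpha ^+ 2,
      (2 * a - 1) * alpha + b * gamma + b^* * beta = 0 &
      a = a ^+ 2 + `|b| ^+ 2 + 2 * `|alpha| ^+ 2 + `|beta| ^+ 2
          + `|gamma| ^+ 2].

Lemma laurent_mx_adj (A0 A1 : 'M[R[i]]_2) z : A0^t* = A0 ->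
  (laurent_mx A0 A1 z)^t* = laurent_mx A0 A1 z.
Proof.
move=> A0h; rewrite -{2}A0h; apply/matrixP => i j.
by rewrite !mxE !rmorphD !rmorphM /= !conjCK addrC addrA [RHS]addrAC addrC !addrA.
Qed.

Lemma mxtrace_laurent (A0 A1 : 'M[R[i]]_2) z :
  \tr (laurent_mx A0 A1 z) = z^* * (\tr A1)^* + \tr A0 + z * \tr A1.
Proof. by rewrite !mxtrace2 !mxE rmorphD /=; ring. Qed.

(** The trace minus 1 is a Hermitian trigonometric polynomial without terms of
    degree 2. *)
Lemma mxtrace_laurent_eq1 (A0 A1 : 'M[R[i]]_2) :
  (forall phi : R, 0 <= phi <= 1 -> \tr (laurent_mx A0 A1 (expi2pi phi)) = 1) ->
  \tr A0 = 1 /\ \tr A1 = 0.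
Proof.
move=> tr1.
have [|/eqP t0 t1 _] := @hermitian_trig_poly_eq0 R (\tr A0 - 1) (\tr A1) 0.
  move=> phi /tr1; rewrite mxtrace_laurent /= rmorph0 => t1.
  by apply: etrans (subrr 1); rewrite -[X in _ = X - _]t1; ring.
by split=> //; apply/eqP; rewrite -subr_eq0.
Qed.

Section Entries.
Variables a b alpha beta gamma : R[i].
Hypothesis a_real : a \is Num.real.

Let L := laurent_mx (mx22 a b b^* (1 - a)) (mx22 alpha beta gamma (- alpha)).
Let e2 := - (alpha ^+ 2 + beta * gamma).
Let e1 := - ((2 * a - 1) * alpha + b * gamma + b^* * beta).
Let e0 := a - (a ^+ 2 + `|b| ^+ 2 + 2 * `|alpha| ^+ 2 + `|beta| ^+ 2
          + `|gamma| ^+ 2).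

Lemma mxtrace_laurent_mx22 z : \tr (L z) = 1.
Proof. by rewrite mxtrace_laurent !mxtrace2 !mxE /= subrr rmorph0; ring. Qed.

(** The two coefficients e2 and e1 are det A1 and - tr (A0 A1), while e0 is
    det A0 - tr (A1 B) with B the adjoint of A1, where A0 and A1 are the two
    matrices combined in L.  The one relation needed beyond conjugation being a
    ring automorphism that fixes a is z z^* = 1. *)
Lemma det_laurent_mx22 z : `|z| = 1 ->
  \det (L z) = z^* ^+ 2 * e2^* + z^* * e1^* + e0 + z * e1 + z ^+ 2 * e2.
Proof.
move=> z1; have zz : z * z^* = 1 by rewrite -normCK z1 expr1n.
have -> : e1^* = - ((2 * a - 1) * alpha^* + b^* * gamma^* + b * beta^*).
  rewrite /e1 rmorphN !rmorphD !rmorphM /=.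
  by rewrite conjCK rmorphB rmorph1 rmorphM rmorph_nat /= (CrealP a_real).
have -> : e2^* = - (alpha^* ^+ 2 + beta^* * gamma^*).
  by rewrite /e2 rmorphN rmorphD rmorphXn rmorphM.
rewrite det2 /L !mxE /= rmorphN /e0 /e1 /e2 !normCK; apply/eqP; rewrite -subr_eq0.
(* The terms that pair A1 with its adjoint carry a factor z z^*, whence a
   discrepancy that is a multiple of 1 - z z^*. *)
apply/eqP; transitivity ((1 - z * z^*) *
    (2 * (alpha * alpha^*) + beta * beta^* + gamma * gamma^*)); first by ring.
by rewrite zz subrr mul0r.
Qed.

Lemma det_laurent_mx22_eq0 : rieffel_eqs a b alpha beta gamma ->
  forall z, `|z| = 1 -> \det (L z) = 0.
Proof.
case=> r1 r2 r3 z z1; rewrite det_laurent_mx22// /e0 -r3 /e1 r2 /e2 r1.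
by rewrite !subrr !oppr0 !rmorph0; ring.
Qed.

Lemma rieffel_eqs_det :
  (forall phi : R, 0 <= phi <= 1 -> \det (L (expi2pi phi)) = 0) ->
  rieffel_eqs a b alpha beta gamma.
Proof.
move=> dL; have [|h0 h1 h2] := @hermitian_trig_poly_eq0 R e0 e1 e2.
  move=> phi /dL; rewrite det_laurent_mx22//.
  by have /set_mem := expi2pi_circle phi.
split.
- by apply/eqP; rewrite -addr_eq0 addrC -oppr_eq0; exact/eqP.
- by apply/eqP; rewrite -oppr_eq0; exact/eqP.
- by apply/eqP; rewrite -subr_eq0; exact/eqP.
Qed.

End Entries.

End Pointwise.

(** * Matrices of continuous functions *)

Section ContinuousMatrices.
Variables (R : realType) (T : topologicalType).

Lemma contC_evalP n (A B : 'M[contC R T]_n) :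
  (forall x, contC_eval A x = contC_eval B x) -> A = B.
Proof.
move=> eAB; apply/matrixP => i j; apply/continuousEP => x.
by have /matrixP/(_ i j) := eAB x; rewrite !mxE.
Qed.

Lemma contC_eval_mul n (A B : 'M[contC R T]_n) x :
  contC_eval (A *m B) x = contC_eval A x *m contC_eval B x.
Proof.
apply/matrixP => i j; rewrite !mxE.
rewrite (big_morph (fun f : contC R T => f x) (id1 := 0) (op1 := +%R))//.
by apply: eq_bigr => k _; rewrite !mxE.
Qed.

Lemma contC_eval_adj n (A : 'M[contC R T]_n) x :
  contC_eval (contC_adj A) x = (contC_eval A x)^t*.
Proof. by apply/matrixP => i j; rewrite !mxE. Qed.

Lemma contC_conjE (f : contC R T) x : contC_conj f x = (f x)^*.
Proof. by []. Qed.

Lemma contC_eval_mx22 (a b c d : contC R T) x :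
  contC_eval (mx22 a b c d) x = mx22 (a x) (b x) (c x) (d x).
Proof. by apply: matrix2P; rewrite !mxE. Qed.

End ContinuousMatrices.

Section RieffelCorrespondence.
Variables (R : realType) (Y : topologicalType).

Lemma circle_coord_continuous :
  continuous (fun p : Y * circle R => set_val p.2 : R[i]).
Proof.
move=> p; apply: (@continuous_comp _ _ _ snd (@set_val _ (circle R))).
  exact: cvg_snd.
exact: initial_continuous.
Qed.

Definition circle_coord : contC R (Y * circle R)%type :=
  mkcts circle_coord_continuous.

Lemma pullback_continuous (f : contC R Y) :
  continuous (fun p : Y * circle R => f p.1).
Proof.
move=> p; apply: continuous_comp; first exact: cvg_fst.
exact: cts_fun.
Qed.

Definition pullback f : contC R (Y * circle R)%type :=
  mkcts (@pullback_continuous f).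

Definition laurent_contC (X0 X1 : 'M[contC R Y]_2) :
    'M[contC R (Y * circle R)%type]_2 :=
  contC_conj circle_coord *: map_mx pullback (contC_adj X1)
  + map_mx pullback X0 + circle_coord *: map_mx pullback X1.

Lemma contC_eval_laurent X0 X1 y z :
  contC_eval (laurent_contC X0 X1) (y, z) =
  laurent_mx (contC_eval X0 y) (contC_eval X1 y) (set_val z).
Proof. by apply/matrixP => i j; rewrite !mxE. Qed.

(** * The correspondence *)

Lemma rieffel_data_eqs (a b alpha beta gamma : contC R Y) :
  rieffel_data a b alpha beta gamma <->
  [/\ forall y, a y \is Num.real,
      contC_norm beta ^+ 2 + contC_norm gamma ^+ 2 <> 0 &
      forall y, rieffel_eqs (a y) (b y) (alpha y) (beta y) (gamma y)].
Proof.
split=> [[ar bg0 r1 r2 r3]|[ar bg0 req]]; split=> //.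
- move=> y; split.
  + by have /continuousEP/(_ y) := r1.
  + by have /continuousEP/(_ y) := r2.
  + by have /continuousEP/(_ y) := r3.
- by apply/continuousEP => y; case: (req y).
- by apply/continuousEP => y; case: (req y).
- by apply/continuousEP => y; case: (req y).
Qed.

(** At each point the Laurent expression has trace 1 and determinant 0, and it
    is Hermitian since X0 is.  Both defining equations of a projection can be
    checked point by point. *)
Lemma rieffel_of_data (a b alpha beta gamma : contC R Y) :
  rieffel_data a b alpha beta gamma ->
  exists P : 'M[contC R (Y * circle R)%type]_2,
    nontrivial_rank_one_rieffel P (mx22 a b (contC_conj b) (1 - a))
      (mx22 alpha beta gamma (- alpha)).
Proof.
move=> /rieffel_data_eqs[ar bg0 req].
set X0 := mx22 _ _ _ _; set X1 := mx22 _ _ _ _.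
have X0h : X0 = contC_adj X0.
  apply: matrix2P; rewrite !mxE; apply/continuousEP => y; rewrite contC_conjE //.
  - by rewrite (CrealP (ar y)).
  - by rewrite contC_conjE conjCK.
  - by rewrite -[(1 - a) y]/(1 - a y) rmorphB rmorph1 /= (CrealP (ar y)).
have rank1 x : let Px := contC_eval (laurent_contC X0 X1) x in
    Px *m Px = Px /\ \rank Px = 1.
  case: x => y z /=; have z1 : `|set_val z| = 1 by exact: set_mem (valP z).
  apply/idempotent_rank1; rewrite contC_eval_laurent !contC_eval_mx22.
  split; first exact: mxtrace_laurent_mx22.
  exact: (det_laurent_mx22_eq0 (ar y) (req y) z1).
exists (laurent_contC X0 X1); split.
- split=> //.
  + split; apply: contC_evalP => x; last by rewrite contC_eval_mul (rank1 x).1.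
    rewrite contC_eval_adj; case: x => y z; rewrite contC_eval_laurent.
    by rewrite laurent_mx_adj// -contC_eval_adj -X0h.
  + by move=> y phi _; rewrite contC_eval_laurent /laurent_mx expi2piN.
- move=> X10; apply: bg0.
  have -> : beta = 0 by move/matrixP/(_ 0 1): X10; rewrite !mxE.
  have -> : gamma = 0 by move/matrixP/(_ 1 0): X10; rewrite !mxE.
  apply/continuousEP => y.
  rewrite -[LHS]/(`|(0 : R[i])| ^+ 2 + `|(0 : R[i])| ^+ 2).
  by rewrite normr0 expr0n addr0.
- by move=> y phi _; case: (rank1 (y, circle_pt phi)).
Qed.

(** The values of P on the circle over y have trace 1 and determinant 0.  The
    trace fixes the shapes of X0 and X1, and then the determinant yields the
    equations at y. *)
Lemma data_of_rieffel (P : 'M[contC R (Y * circle R)%type]_2)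
    (X0 X1 : 'M[contC R Y]_2) :
  nontrivial_rank_one_rieffel P X0 X1 ->
  exists a b alpha beta gamma : contC R Y,
    [/\ rieffel_data a b alpha beta gamma,
        X0 = mx22 a b (contC_conj b) (1 - a) &
        X1 = mx22 alpha beta gamma (- alpha)].
Proof.
move=> [[[_ PP] X0h PE] X10 rP].
have trdet y (phi : R) : 0 <= phi <= 1 ->
    \tr (laurent_mx (contC_eval X0 y) (contC_eval X1 y) (expi2pi phi)) = 1 /\
    \det (laurent_mx (contC_eval X0 y) (contC_eval X1 y) (expi2pi phi)) = 0.
  move=> phi01; apply/idempotent_rank1.
  rewrite /laurent_mx -expi2piN -PE// -contC_eval_mul PP; split=> //.
  exact: rP.
have tr01 y : \tr (contC_eval X0 y) = 1 /\ \tr (contC_eval X1 y) = 0.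
  by apply: mxtrace_laurent_eq1 => phi /(trdet y)[].
have X0E : X0 = mx22 (X0 0 0) (X0 0 1) (contC_conj (X0 0 1)) (1 - X0 0 0).
  apply: matrix2P; rewrite ?[RHS]mxE //=; first by rewrite {1}X0h !mxE.
  apply/continuousEP => y; have [+ _] := tr01 y; rewrite mxtrace2 !mxE => t1.
  by rewrite -[RHS]/(1 - X0 0 0 y) -t1 addrAC subrr add0r.
have X1E : X1 = mx22 (X1 0 0) (X1 0 1) (X1 1 0) (- X1 0 0).
  apply: matrix2P; rewrite ?[RHS]mxE //=.
  apply/continuousEP => y; have [_ +] := tr01 y; rewrite mxtrace2 !mxE => t0.
  by apply/eqP; rewrite -[X in _ == X]/(- X1 0 0 y) -addr_eq0 addrC t0.
exists (X0 0 0), (X0 0 1), (X1 0 0), (X1 0 1), (X1 1 0); split=> //.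
have ar y : X0 0 0 y \is Num.real.
  apply/CrealP; move/matrixP/(_ 0 0): X0h.
  by rewrite !mxE => /continuousEP/(_ y); rewrite contC_conjE => <-.
have req y : rieffel_eqs (X0 0 0 y) (X0 0 1 y) (X1 0 0 y) (X1 0 1 y) (X1 1 0 y).
  apply: rieffel_eqs_det => // phi /(trdet y)[_].
  by rewrite X0E X1E !contC_eval_mx22 !mxE.
apply/rieffel_data_eqs; split=> // bg0; apply: X10.
have bg y : X1 0 1 y = 0 /\ X1 1 0 y = 0.
  move/continuousEP/(_ y): bg0.
  rewrite -[LHS]/(`|X1 0 1 y| ^+ 2 + `|X1 1 0 y| ^+ 2) => /eqP.
  by rewrite paddr_eq0 ?exprn_ge0// !sqrf_eq0 !normr_eq0 => /andP[/eqP ? /eqP ?].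
(* Nontriviality: where beta vanishes, beta gamma = - alpha^2 kills alpha. *)
have al0 y : X1 0 0 y = 0.
  have [+ _ _] := req y; rewrite (bg y).1 mul0r => /esym/eqP.
  by rewrite oppr_eq0 sqrf_eq0 => /eqP.
rewrite X1E; apply: matrix2P; rewrite !mxE; apply/continuousEP => y.
- exact: al0.
- exact: (bg y).1.
- exact: (bg y).2.
- by rewrite -[LHS]/(- X1 0 0 y) al0 oppr0.
Qed.

End RieffelCorrespondence.

Theorem proposition1p2 (R : realType) (Y : topologicalType)
    (Ycompact : compact [set: Y]) :
  [/\ (exists (P : 'M[contC R (Y * circle R)%type]_2)
              (X0 X1 : 'M[contC R Y]_2),
         nontrivial_rank_one_rieffel P X0 X1)
      <-> (exists a b alpha beta gamma : contC R Y,
             rieffel_data a b alpha beta gamma),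
      forall a b alpha beta gamma : contC R Y,
        rieffel_data a b alpha beta gamma ->
        exists P : 'M[contC R (Y * circle R)%type]_2,
          nontrivial_rank_one_rieffel P
            (mx22 a b (contC_conj b) (1 - a))
            (mx22 alpha beta gamma (- alpha)) &
      forall (P : 'M[contC R (Y * circle R)%type]_2)
             (X0 X1 : 'M[contC R Y]_2),
        nontrivial_rank_one_rieffel P X0 X1 ->
        exists a b alpha beta gamma : contC R Y,
          [/\ rieffel_data a b alpha beta gamma,
              X0 = mx22 a b (contC_conj b) (1 - a) &
              X1 = mx22 alpha beta gamma (- alpha)]].
Proof.
split; last exact: data_of_rieffel; last exact: rieffel_of_data.
split=> [[P [X0 [X1 /data_of_rieffel]]]|[a [b [alpha [beta [gamma]]]]]].
  by case=> a [b [alpha [beta [gamma [? _ _]]]]]; exists a, b, alpha, beta, gamma.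
by move=> /rieffel_of_data[P ?]; exists P; do 2 eexists; eassumption.
Qed.
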